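(* Let $p$ be an odd prime and let $V_2(0,p-1)$ be the number of distinct residues modulo $p$ of the products $n_1!\,n_2!$ with $1\le n_1,n_2\le p-1$ (equivalently, the number of $a\in\mathbb{F}_p^*$ such that $n_1!n_2!\equiv a\pmod p$ for some $1\le n_1,n_2\le p-1$). Then $$V_2(0,p-1)\ge\frac58p+O\!\left(p^{1/2}\log^2 p\right).$$
   Context: The implied constant is absolute. *)

(* Defs.v *)
From mathcomp Require Import all_boot.

Set Implicit Arguments.
Unset Strict Implicit.
Unset Printing Implicit Defensive.

(* V_2(H, N): both arguments of the factorials range over H + 1, ..., H + N. *)
Definition V2 (p H N : nat) : nat :=
  size (undup [seq (n1`! * n2`!) %% p | n1 <- iota H.+1 N, n2 <- iota H.+1 N]).

(* Main.v *)
Require Import Defs.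
From mathcomp Require Import all_boot all_order all_algebra.
From mathcomp Require Import ring lra zify.
From mathcomp Require Import complex reals topology normedtype derive exp trigo.

Import Order.TTheory GRing.Theory Num.Theory.
Import numFieldNormedType.Exports.
Local Open Scope ring_scope.

(** Put [h = (p - 1) / 2]. By Wilson's theorem [n! (p - 1 - n)! = (-1)^(n+1)]
    in [F_p], whence for [1 <= k <= h]
      [(2k)! (p - 2k)! = 2k]   and   [(2k)! (p + 1 - 2k)! = - 2k (2k - 1)].
    The first family yields all [h] even residues. The second one yields an odd
    residue as soon as [k (2k - 1) mod p] lies in [[1, h]], and each value is
    attained at most twice. So it remains to show that [k] and [k (2k - 1)] lie
    in [[1, h]] simultaneously for [p / 4 + O(p^(1/2) log^2 p)] values of [k].
    Expanding both indicator functions in additive characters, the error is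
    bounded by a Gauss sum, of modulus [p^(1/2)], times the square of the
    normalised l^1 norm of the Fourier transform of [[1, h]], which is
    [O(log p)]. *)

(** * Factorials modulo [p] and the residues they produce *)

Lemma Fp_nat_eq (p m n : nat) :
  prime p -> ((m%:R : 'F_p) == n%:R) = (m == n %[mod p])%N.
Proof.
by move=> p_pr; rewrite -val_eqE /= !val_Fp_nat.
Qed.

(** Induction from Wilson's theorem: passing from [n] to [n + 1] gains the factor [n + 1] and loses
    [p - 1 - n], which is [-(n + 1)] in ['F_p]. *)
Lemma fact_mul_fact_compl (p n : nat) : prime p -> (n < p)%N ->
  n`!%:R * (p.-1 - n)`!%:R = (-1) ^+ n.+1 :> 'F_p.
Proof.
move=> p_pr; elim: n => [|n IHn] lt_np.
  rewrite subn0 fact0 mul1r expr1; apply/eqP.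
  rewrite -addr_eq0 natr1 (_ : 0 = 0%:R) // Fp_nat_eq // mod0n.
  by rewrite -/(dvdn _ _) -Wilson ?prime_gt1.
have e : (p.-1 - n = (p.-1 - n.+1).+1)%N by lia.
have := IHn (ltnW lt_np); rewrite e factS natrM => IH.
have e2 : ((p.-1 - n.+1).+1%:R : 'F_p) = - n.+1%:R.
  apply/eqP; rewrite -addr_eq0 -natrD (_ : _ + _ = p)%N; last by lia.
  by rewrite pchar_Fp_0.
rewrite factS natrM [RHS]exprS -IH e2; ring.
Qed.

Definition half_interval (p : nat) : {set 'F_p} :=
  [set x : 'F_p | 0 < x <= p.-1./2]%N.

(* The [k] for which the residue of [- 2k (2k - 1)] in [[0, p - 1]] is odd: it is
   [p - 2y] with [y] the residue of [2k^2 - k]. *)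
Definition low_hits (p : nat) : {set 'F_p} :=
  [set x in half_interval p | 2 * x ^+ 2 - x \in half_interval p].

Lemma fact_prod_mem (p n m : nat) : (0 < n < p)%N -> (0 < m < p)%N ->
  (n`! * m`! %% p)%N \in
    [seq (n1`! * n2`!) %% p | n1 <- iota 1 p.-1, n2 <- iota 1 p.-1]%N.
Proof.
move=> Hn Hm; apply/allpairsP; exists (n, m) => /=.
by rewrite !mem_iota; split=> //; lia.
Qed.

Lemma Fp_ltn (p : nat) (x : 'F_p) : prime p -> (x < p)%N.
Proof. by move=> p_pr; have := ltn_ord x; rewrite [X in (_ < X)%N]Fp_cast. Qed.

Lemma even_mem_V2 (p k : nat) : prime p -> odd p -> (0 < k <= p.-1./2)%N ->
  (2 * k)%N \in
    [seq (n1`! * n2`!) %% p | n1 <- iota 1 p.-1, n2 <- iota 1 p.-1]%N.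
Proof.
move=> p_pr p_odd Hk.
rewrite [X in X \in _](_ : _ = (2 * k)`! * (p - 2 * k)`! %% p)%N.
  by apply: fact_prod_mem; lia.
rewrite -[LHS](@modn_small _ p); last by lia.
apply/eqP; rewrite -Fp_nat_eq // !natrM.
have -> : (p - 2 * k = (p.-1 - 2 * k).+1)%N by lia.
rewrite factS natrM mulrCA fact_mul_fact_compl //; last by lia.
rewrite exprS mul2n -signr_odd odd_double expr0 mulr1 mulrN1.
by rewrite -addr_eq0 -natrM -natrD (_ : _ + _ = p)%N ?pchar_Fp_0 //; lia.
Qed.

(** Beyond [(p - 1 - 2x)!], the factorial of [p + 1 - 2x] has the factors [1 - 2x] and [- 2x]; with
    the sign [-1] of the complement product this gives [2x (1 - 2x)], which is minus twice
    [2x^2 - x]. *)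
Lemma odd_mem_V2 (p : nat) (x : 'F_p) : prime p -> odd p -> x \in low_hits p ->
  (p - 2 * (2 * x ^+ 2 - x)%R)%N \in
    [seq (n1`! * n2`!) %% p | n1 <- iota 1 p.-1, n2 <- iota 1 p.-1]%N.
Proof.
move=> p_pr p_odd; rewrite !inE.
set y := 2 * x ^+ 2 - x => /andP[Hx Hy].
rewrite [X in X \in _](_ : _ = (2 * x)`! * (p.+1 - 2 * x)`! %% p)%N.
  by apply: fact_prod_mem; lia.
rewrite -[LHS](@modn_small _ p); last by lia.
apply/eqP; rewrite -Fp_nat_eq // !natrM.
have -> : (p.+1 - 2 * x = (p.-1 - 2 * x).+2)%N by lia.
rewrite !factS !natrM mulrCA [X in _ * X]mulrCA fact_mul_fact_compl //; last by lia.
rewrite exprS -signr_odd oddM expr0 mulr1.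
have p0 := pchar_Fp_0 p_pr.
have -> : ((p.-1 - 2 * x).+2%:R : 'F_p) = 1 - 2 * x.
  apply/eqP; rewrite eq_sym subr_eq -{2}(natr_Zp x) -natrM -natrD.
  by rewrite (_ : _ + _ = p + 1)%N ?natrD ?p0 ?add0r //; lia.
have -> : ((p.-1 - 2 * x).+1%:R : 'F_p) = - 2 * x.
  apply/eqP; rewrite mulNr -addr_eq0 -{2}(natr_Zp x) -natrM -natrD.
  by rewrite (_ : _ + _ = p)%N ?p0 //; lia.
apply/eqP; rewrite natrB ?p0; last by lia.
rewrite natrM natr_Zp /y; ring.
Qed.

(* Equal values force [x = y] or [2 (x + y) = p + 1], and in the latter case
   [(p + 1) / 4] lies between [x] and [y]. *)
Lemma low_hits_inj (p : nat) (x y : 'F_p) : prime p -> odd p ->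
  x \in low_hits p -> y \in low_hits p ->
  (4 * x <= p)%N = (4 * y <= p)%N ->
  2 * x ^+ 2 - x = 2 * y ^+ 2 - y -> x = y.
Proof.
move=> p_pr p_odd; rewrite !inE => /andP[Hx _] /andP[Hy _] Hxy.
move/eqP; rewrite -subr_eq0.
rewrite (_ : _ - _ = (x - y) * (2 * (x + y) - 1)); last by ring.
rewrite mulf_eq0 subr_eq0 => /orP[/eqP//|].
rewrite -{1}(natr_Zp x) -{1}(natr_Zp y) -natrD -natrM.
rewrite -[X in _ - X == _]/(1%:R) -natrB; last by lia.
rewrite (_ : 0 = 0%:R) // Fp_nat_eq // mod0n => /dvdnP[c Hc].
apply/val_inj => /=.
have {Hc} : (2 * (x + y) - 1 = p)%N.
  have : (c < 2)%N by nia.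
  by case: c Hc => [|[|]] //; lia.
lia.
Qed.

(** The cut at [p / 4] splits [low_hits] into two classes, each giving distinct odd residues. Each
    class joined to the even residues bounds [V2] from below, and the two bounds are added. *)
Lemma V2_ge (p : nat) : prime p -> odd p ->
  (2 * p.-1./2 + #|low_hits p| <= 2 * V2 p 0 p.-1)%N.
Proof.
move=> p_pr p_odd.
pose f (x : 'F_p) := (p - 2 * (2 * x ^+ 2 - x)%R)%N.
pose s := [seq (2 * k)%N | k <- iota 1 p.-1./2].
have sub_inj (a b : nat) : (0 < a <= p.-1./2 -> 0 < b <= p.-1./2 ->
    p - 2 * a = p - 2 * b -> a = b)%N by lia.
pose K b := [set x in low_hits p | (4 * x <= p)%N == b].
have key (b : bool) : (p.-1./2 + #|K b| <= V2 p 0 p.-1)%N.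
  have -> : (p.-1./2 + #|K b|)%N = size (s ++ [seq f x | x <- enum (K b)]).
    by rewrite size_cat !size_map size_iota -cardE.
  apply: uniq_leq_size.
    rewrite cat_uniq; apply/and3P; split.
    - by rewrite map_inj_uniq ?iota_uniq // => i j; lia.
    (* Parity: [2 * y < p] makes the subtraction genuine, so [p - 2 * y] is odd. *)
    - apply/hasPn => z /mapP[x]; rewrite mem_enum in_set => /andP[Hx _] ->.
      apply/negP => /mapP[k _]; rewrite /f.
      move: Hx; rewrite !inE => /andP[_]; move: (nat_of_ord _) => y; lia.
    - rewrite map_inj_in_uniq ?enum_uniq // => x y.
      rewrite !mem_enum in_set => /andP[Hx /eqP bx].
      rewrite in_set => /andP[Hy /eqP b_y] exy.
      apply: low_hits_inj => //; first by rewrite bx b_y.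
      move: Hx Hy; rewrite !inE => /andP[_ Hx] /andP[_ Hy].
      by apply: ord_inj; exact: (sub_inj _ _ Hx Hy exy).
  move=> z; rewrite mem_undup mem_cat => /orP[] /mapP[].
    by move=> k; rewrite mem_iota => Hk ->; apply: even_mem_V2; lia.
  by move=> x; rewrite mem_enum in_set => /andP[Hx _] ->; apply: odd_mem_V2.
have := leq_add (key true) (key false).
rewrite -(cardsID [set x : 'F_p | (4 * x <= p)%N] (low_hits p)).
rewrite (_ : _ :&: _ = K true); last first.
  by apply/setP => x; rewrite inE !in_set eqb_id.
rewrite (_ : _ :\: _ = K false); last first.
  by apply/setP => x; rewrite inE !in_set eqbF_neg andbC.
by move: #|K true| #|K false| => a b; lia.
Qed.

(** * Additive characters of ['F_p]: Fourier inversion, Gauss sums, counting *)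

Definition Fp_char (C : numClosedFieldType) (p : nat) (z : C) (x : 'F_p) : C :=
  z ^+ x.

Section FpCharacters.
Variables (C : numClosedFieldType) (p : nat) (z : C).
Hypotheses (p_pr : prime p) (zP : p.-primitive_root z).
Local Notation psi := (@Fp_char C p z).

Lemma Fp_char_nat (n : nat) : psi n%:R = z ^+ n.
Proof. by rewrite /Fp_char val_Fp_nat // expr_mod // prim_expr_order. Qed.

Lemma Fp_charD (x y : 'F_p) : psi (x + y) = psi x * psi y.
Proof.
by rewrite -[x in LHS]natr_Zp -[y in LHS]natr_Zp -natrD Fp_char_nat exprD.
Qed.

Lemma Fp_char0 : psi 0 = 1. Proof. exact: expr0. Qed.

Lemma Fp_charMn (x : 'F_p) (n : nat) : psi (x *+ n) = psi x ^+ n.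
Proof.
elim: n => [|n IHn]; first by rewrite mulr0n Fp_char0 expr0.
by rewrite mulrS exprS Fp_charD IHn.
Qed.

Lemma Fp_char_eq1 (x : 'F_p) : (psi x == 1) = (x == 0).
Proof.
rewrite /Fp_char -(prim_order_dvd zP) -{2}(natr_Zp x).
by rewrite -val_eqE /= val_Fp_nat.
Qed.

Lemma norm_Fp_char (x : 'F_p) : `|psi x| = 1.
Proof.
have p0 := prime_gt0 p_pr; apply/eqP; rewrite normrX.
suff /eqP-> : `|z| == 1 by rewrite expr1n.
by rewrite -(pexpr_eq1 p0) ?normr_ge0 // -normrX prim_expr_order ?normr1.
Qed.

Lemma conj_Fp_char (x : 'F_p) : (psi x)^* = psi (- x).
Proof.
have nz : psi x != 0 by rewrite -normr_eq0 norm_Fp_char oner_eq0.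
by apply: (mulfI nz); rewrite -normCK norm_Fp_char expr1n -Fp_charD subrr Fp_char0.
Qed.

(** Orthogonality: shifting [x] by one multiplies the sum by [psi c], which differs from 1 when [c]
    is nonzero. *)
Lemma sum_Fp_char (c : 'F_p) : \sum_x psi (c * x) = p%:R *+ (c == 0).
Proof.
case: eqP => [->|/eqP c0].
  under eq_bigr do rewrite mul0r Fp_char0.
  by rewrite sumr_const card_Fp.
set S := \sum_x _; have : S * psi c = S.
  rewrite [RHS](reindex_inj (addIr 1)) /= mulr_suml.
  by apply: eq_bigr => x _; rewrite mulrDr mulr1 Fp_charD.
move/eqP; rewrite -{2}[S]mulr1 -subr_eq0 -mulrBr mulf_eq0 subr_eq0 Fp_char_eq1.
by rewrite (negPf c0) orbF => /eqP.
Qed.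

(** Fourier coefficient of the indicator of [A], left unnormalised, so that inversion carries a
    factor [p]. *)
Definition Fp_coef (A : {set 'F_p}) (a : 'F_p) : C := \sum_(x in A) psi (- (a * x)).

Lemma Fp_fourier_inversion (A : {set 'F_p}) (x : 'F_p) :
  \sum_a Fp_coef A a * psi (a * x) = p%:R *+ (x \in A).
Proof.
under eq_bigr do rewrite mulr_suml.
rewrite exchange_big /= (eq_bigr (fun y => p%:R *+ (x == y))) => [|y _]; last first.
  rewrite eq_sym -subr_eq0 -opprB oppr_eq0 -sum_Fp_char; apply: eq_bigr => a _.
  by rewrite -Fp_charD; congr psi; ring.
have [xA|xA] := boolP (x \in A).
  rewrite (bigD1 x xA) /= eqxx big1 ?addr0 // => y /andP[_ yx].
  by rewrite eq_sym (negPf yx).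
by rewrite big1 // => y yA; case: eqP xA => // ->; rewrite yA.
Qed.

(** Square the modulus and substitute [x = d + y]: since [f (d + y) - f y = f d + 4 b d y] and [4 b]
    is nonzero, the sum over [y] vanishes unless [d = 0], which contributes [p]. *)
Lemma norm_gauss_sum (a b : 'F_p) (f := fun x => a * x + b * (2 * x ^+ 2 - x)) :
  odd p -> b != 0 -> `|\sum_x psi (f x)| = sqrtC p%:R.
Proof.
move=> p_odd b0; apply/eqP.
rewrite -(eqrXn2 (n := 2)) ?sqrtC_ge0 ?ler0n // sqrtCK normCK rmorph_sum.
have two0 : (2%:R : 'F_p) != 0.
  rewrite -[0]/0%:R Fp_nat_eq // mod0n modn_small //.
  by case: p p_pr p_odd => [|[|[|]]].
rewrite mulr_suml.
under eq_bigr do rewrite mulr_sumr.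
rewrite exchange_big /=.
under eq_bigr => y _ do rewrite (reindex_inj (addIr y)) /=.
rewrite exchange_big /= (bigD1 0) //= [X in _ + X]big1 ?addr0 => [|d d0].
  rewrite (eq_bigr (fun=> 1)) => [|y _]; first by rewrite sumr_const card_Fp.
  by rewrite add0r -normCK norm_Fp_char expr1n.
rewrite (eq_bigr (fun y => psi (f d) * psi (4 * b * d * y))) => [|y _].
  rewrite -mulr_sumr sum_Fp_char (_ : 4 * b * d == 0 = false) ?mulr0 //.
  rewrite (_ : 4 = 2 * 2) ?mulf_eq0 -?natrM //.
  by rewrite (negPf two0) (negPf b0) (negPf d0).
by rewrite conj_Fp_char -!Fp_charD; congr psi; rewrite /f; ring.
Qed.

(** In the double Fourier expansion, [a = b = 0] gives the main term, [b = 0] with [a] nonzero gives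
    nothing by orthogonality, and each nonzero [b] brings a Gauss sum. *)
Lemma count_hits_bound (A B : {set 'F_p}) (f := fun x : 'F_p => 2 * x ^+ 2 - x) :
  odd p ->
  `|p%:R ^+ 2 * #|[set x in A | f x \in B]|%:R - p%:R * #|A|%:R * #|B|%:R|
    <= sqrtC p%:R * (\sum_a `|Fp_coef A a|) * (\sum_a `|Fp_coef B a|).
Proof.
move=> p_odd.
have H : p%:R ^+ 2 * #|[set x in A | f x \in B]|%:R =
   \sum_b \sum_a Fp_coef A a * Fp_coef B b * \sum_x psi (a * x + b * f x).
  transitivity (\sum_x (p%:R *+ (x \in A)) * (p%:R *+ (f x \in B)) : C).
    rewrite -sum1_card natr_sum mulr_sumr big_mkcond /=; apply: eq_bigr => x _.
    by rewrite inE; case: (x \in A); case: (f x \in B);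
      rewrite ?mulr1n ?mulr0n; ring.
  transitivity (\sum_x \sum_b \sum_a
    Fp_coef A a * Fp_coef B b * psi (a * x + b * f x)).
    apply: eq_bigr => x _; rewrite -!Fp_fourier_inversion mulr_sumr.
    apply: eq_bigr => b _; rewrite mulr_suml.
    by apply: eq_bigr => a _; rewrite Fp_charD; ring.
  rewrite exchange_big /=; apply: eq_bigr => b _.
  rewrite exchange_big /=; apply: eq_bigr => a _.
  exact/esym/mulr_sumr.
have c0 D : Fp_coef D 0 = #|D|%:R.
  rewrite /Fp_coef; under eq_bigr do rewrite mul0r oppr0 Fp_char0.
  by rewrite sumr_const.
rewrite H (bigD1 0) //= (bigD1 0) //= [X in _ + X + _ + _]big1 => [|a a0].
  rewrite addr0 !c0.
  have -> : \sum_x psi (0 * x + 0 * f x) = p%:R.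
    transitivity (\sum_x psi (0 * x)); last by rewrite sum_Fp_char eqxx.
    by apply: eq_bigr => x _; congr psi; ring.
  rewrite (_ : _ * _ * p%:R = p%:R * #|A|%:R * #|B|%:R); last by ring.
  rewrite addrAC subrr add0r.
  apply: (le_trans (ler_norm_sum _ _ _)).
  (* The bound sums over all [b]; its term at [b = 0] is nonnegative and is dropped. *)
  rewrite mulr_sumr [leRHS](bigD1 0) //= ler_wpDl //.
    by rewrite !mulr_ge0 ?sqrtC_ge0 ?ler0n ?sumr_ge0.
  apply: ler_sum => b b0; apply: (le_trans (ler_norm_sum _ _ _)).
  rewrite mulr_sumr mulr_suml; apply: ler_sum => a _.
  by rewrite !normrM norm_gauss_sum // [leLHS]mulrC mulrA.
rewrite (eq_bigr (fun x => psi (a * x))) ?sum_Fp_char ?(negPf a0) ?mulr0 // => x _.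
by rewrite mul0r addr0.
Qed.

End FpCharacters.

(** * The half interval and its Fourier coefficients *)

Lemma big_half_interval (T : Type) (idx : T) (op : Monoid.com_law idx) (p : nat)
    (F : nat -> T) : prime p ->
  \big[op/idx]_(x in half_interval p) F x =
  \big[op/idx]_(1 <= k < p.-1./2.+1) F k.
Proof.
move=> p_pr; have le_hp : (p.-1./2.+1 <= (Zp_trunc (pdiv p)).+2)%N.
  by rewrite Fp_cast //; have := prime_gt1 p_pr; lia.
rewrite (big_nat_widen _ _ _ _ _ le_hp) (big_nat_widenl _ 0) // big_mkord.
by apply: eq_bigl => x; rewrite inE andbC.
Qed.

Lemma card_half_interval (p : nat) : prime p -> #|half_interval p| = p.-1./2.
Proof.
move=> p_pr; rewrite -sum1_card (big_half_interval _ _ _ _ (fun=> 1%N)) //.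
by rewrite big_const_nat iter_addn_0 subSS subn0 mul1n.
Qed.

(** A geometric sum: times [1 - w] it telescopes to a difference of two numbers of modulus 1. The
    product form also covers [a = 0]. *)
Lemma norm_half_coef (C : numClosedFieldType) (p : nat) (z : C) (a : 'F_p) :
  prime p -> p.-primitive_root z ->
  `|Fp_coef C p z (half_interval p) a| * `|1 - z ^+ a| <= 2.
Proof.
move=> p_pr zP; set w : C := Fp_char C p z (- a).
have norm_w n : `|w ^+ n| = 1 by rewrite normrX norm_Fp_char // expr1n.
have -> : `|1 - z ^+ a| = `|1 - w|.
  by rewrite /w -conj_Fp_char // -[RHS]norm_conjC rmorphB rmorph1 /= conjCK.
have -> : Fp_coef C p z (half_interval p) a = \sum_(1 <= k < p.-1./2.+1) w ^+ k.
  rewrite /Fp_coef (eq_bigr (fun x : 'F_p => w ^+ x)) => [|x _]; last first.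
    by rewrite -mulNr -{1}(natr_Zp x) mulr_natr Fp_charMn.
  exact: big_half_interval.
rewrite -normrM mulrC.
have -> n : (1 - w) * \sum_(1 <= k < n.+1) w ^+ k = w - w ^+ n.+1.
  rewrite mulr_sumr (eq_bigr (fun k => - (w ^+ k.+1 - w ^+ k))) => [|k _].
    by rewrite sumrN telescope_sumr // opprB expr1.
  by rewrite exprS; ring.
apply: (le_trans (ler_normB _ _)).
by rewrite norm_w -[X in `|X|]expr1 norm_w.
Qed.

Lemma big_Fp_nonzero (T : Type) (idx : T) (op : Monoid.com_law idx) (p : nat)
    (F : nat -> T) : prime p ->
  \big[op/idx]_(x : 'F_p | x != 0) F x = \big[op/idx]_(1 <= k < p) F k.
Proof.
move=> p_pr; have -> : \big[op/idx]_(1 <= k < p) F k =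
    \big[op/idx]_(1 <= k < (Zp_trunc (pdiv p)).+2) F k by rewrite Fp_cast.
rewrite (big_nat_widenl _ 0) // big_mkord.
by apply: eq_bigl => x; rewrite -val_eqE lt0n.
Qed.

(** * Real estimates, with the root of unity [exp (2 pi i / p)] *)

Section RealBounds.
Variable R : realType.
Local Open Scope complex_scope.

(* [sin x = 2 sin (x/2) cos (x/2) >= x cos^2 (x/2) = x (1 + cos x) / 2]. *)
Lemma sin_ge_half (x : R) : 0 <= x <= pi / 2 -> x / 2 <= sin x.
Proof.
move=> /andP[x0 xpi]; have pi0 := pi_gt0 R.
have y0 : 0 <= x / 2 by lra.
(* The mean value theorem gives [sin (x / 2) = (x / 2) cos c] with [c <= x / 2], and the cosine
   decreases on this range. *)
have [|c] := @MVT_segment R sin cos 0 (x / 2) y0.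
  exact/continuous_subspaceT/continuous_sin.
rewrite in_itv /= sin0 !subr0 => /andP[c0 cx] sinE.
have cos_le : cos (x / 2) <= cos c.
  rewrite leNgt; apply/negP; rewrite ltr_cos ?in_itv /=; lra.
have cosx0 : 0 <= cos x by apply: cos_ge0_pihalf; lra.
have ex : x = (x / 2) *+ 2 by lra.
have : cos (x / 2) ^+ 2 *+ 2 = 1 + cos x.
  by rewrite [in RHS]ex cos_mulr2n; ring.
have cos0' : 0 <= cos (x / 2) by apply: cos_ge0_pihalf; lra.
rewrite [X in _ <= sin X]ex sin_mulr2n sinE => cos2.
have : cos (x / 2) ^+ 2 <= cos (x / 2) * cos c by rewrite expr2 ler_wpM2l.
rewrite mulrA; move: (cos (x / 2) * cos c) => u u_ge.
have u1 : 1 <= u *+ 2 by lra.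
by nra.
Qed.

(** By [ln (1 - u) <= - u] at [u = 1 / (n + 2)], the new term is at most
    [ln (n + 2) - ln (n + 1)]. *)
Lemma harmonic_le_ln (n : nat) :
  \sum_(1 <= k < n.+2) (k%:R)^-1 <= 1 + ln n.+1%:R :> R.
Proof.
elim: n => [|n IHn]; first by rewrite big_nat1 invr1 ln1 addr0.
rewrite big_nat_recr //=; apply: (le_trans (lerD IHn (lexx _))).
rewrite -addrA lerD2l.
have pos m : (0 < m.+1%:R :> R) by rewrite ltr0n.
have : ln (n.+1%:R / n.+2%:R) <= - (n.+2%:R)^-1 :> R.
  have -> : n.+1%:R / n.+2%:R = 1 + - (n.+2%:R)^-1 :> R.
    have := lt0r_neq0 (pos n.+1); rewrite -[n.+2%:R]natr1; move: n.+1%:R => m nz.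
    by field.
  by apply: le_ln1Dx; rewrite ltrN2 invf_lt1 ?ltr1n.
rewrite ln_div ?posrE ?pos //.
by move: (ln n.+1%:R) (ln n.+2%:R) (n.+2%:R^-1) => a b c; lra.
Qed.

Definition zeta (p : nat) : R[i] := cos (pi *+ 2 / p%:R) +i* sin (pi *+ 2 / p%:R).

Lemma zetaX (p n : nat) :
  zeta p ^+ n = cos (pi *+ 2 / p%:R *+ n) +i* sin (pi *+ 2 / p%:R *+ n).
Proof.
rewrite /zeta; move: (pi *+ 2 / p%:R) => t.
elim: n => [|n IHn]; first by rewrite expr0 !mulr0n cos0 sin0.
rewrite exprS IHn !mulrS cosD sinD; apply/eqP; rewrite eq_complex /=.
by apply/andP; split; apply/eqP; ring.
Qed.

Lemma norm_1_sub_zetaX (p n : nat) :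
  `|1 - zeta p ^+ n| = (2 * `|sin (pi / p%:R *+ n)|)%:C.
Proof.
rewrite zetaX normc_def /=; congr (_ %:C).
set u : R := pi / p%:R *+ n.
have -> : pi *+ 2 / p%:R *+ n = u *+ 2 by rewrite /u -mulrnAl; ring.
rewrite cos_mulr2n sin_mulr2n.
have -> : (1 - (cos u ^+ 2 *+ 2 - 1)) ^+ 2 + (0 - (cos u * sin u) *+ 2) ^+ 2 =
    (2 * sin u) ^+ 2.
  by have := cos2Dsin2 u; nra.
by rewrite sqrtr_sqr normrM ger0_norm.
Qed.

(** The order divides the prime [p], and order 1 would force [sin (pi / p) = 0]. *)
Lemma zeta_primitive (p : nat) : prime p -> p.-primitive_root (zeta p).
Proof.
move=> p_pr.
have p0 := prime_gt0 p_pr.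
have pR : (p%:R != 0 :> R) by rewrite pnatr_eq0 -lt0n.
have e : zeta p ^+ p = 1.
  by rewrite zetaX -mulr_natr divfK // cos2pi sin2pi.
have [m mP mp] := prim_order_exists p0 e.
suff m1 : m != 1%N by move: mP; rewrite (prime_nt_dvdP p_pr m1 mp).
apply: contraTneq mP => ->; apply/negP => /prim_expr_order r1.
have := norm_1_sub_zetaX p 1; rewrite r1 subrr normr0 mulr1n.
move=> /(congr1 (@complex.Re R)) /= /esym/eqP.
rewrite mulf_eq0 pnatr_eq0 normr_eq0 /=; apply/negP; rewrite lt0r_neq0 //.
by apply: sin_gt0_pi; rewrite divr_gt0 ?pi_gt0 ?ltr0n // ltr_pdivrMr ?ltr0n //
  ltr_pMr ?pi_gt0 // ltr1n prime_gt1.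
Qed.

Lemma sin_pi_frac_ge (p n : nat) : (0 < p)%N -> (2 * n <= p)%N ->
  n%:R / p%:R <= sin (pi / p%:R *+ n) :> R.
Proof.
move=> p0 np; have pR : 0 < p%:R :> R by rewrite ltr0n.
have nR : 0 <= n%:R / p%:R :> R by rewrite divr_ge0 ?ler0n.
have nR2 : n%:R / p%:R <= 1 / 2 :> R.
  by rewrite ler_pdivrMr // mul1r ler_pdivlMl // -natrM ler_nat.
have := pi_ge2 R; have -> : pi / p%:R *+ n = pi * (n%:R / p%:R) :> R.
  by rewrite -mulr_natr; ring.
move: (n%:R / p%:R) nR nR2 => t t0 t1 pi2.
have : pi * t / 2 <= sin (pi * t) by apply: sin_ge_half; nra.
by apply: le_trans; nra.
Qed.

(** Whichever of [n] and [p - n] is at most [p / 2] suffices, as both have the same sine; adding the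
    two reciprocals gives one formula for both cases. *)
Lemma inv_sin_pi_frac_le (p n : nat) : (0 < n < p)%N ->
  1 <= (p%:R / n%:R + p%:R / (p - n)%:R) * `|sin (pi / p%:R *+ n)| :> R.
Proof.
move=> /andP[n0 np]; set m := (p - n)%N; have p0 : (0 < p)%N by lia.
have m0 : (0 < m)%N by rewrite subn_gt0.
have sinE : sin (pi / p%:R *+ n) = sin (pi / p%:R *+ m) :> R.
  have -> : pi / p%:R *+ n = pi - pi / p%:R *+ m :> R.
    apply/eqP; rewrite eq_sym subr_eq -mulrnDr subnKC ?(ltnW np) //.
    by rewrite -[pi / _ *+ _]mulr_natr divfK // pnatr_eq0 -lt0n.
  by rewrite sinB sinpi cospi; ring.
have key (k : nat) (c s : R) : (0 < k)%N -> 0 <= c -> k%:R / p%:R <= s ->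
    1 <= (p%:R / k%:R + c) * `|s|.
  move=> k0 c0 ks; apply: le_trans (_ : p%:R / k%:R * (k%:R / p%:R) <= _).
    by rewrite mulrA divfK ?divff // pnatr_eq0 -lt0n.
  apply: ler_pM; rewrite ?divr_ge0 ?ler0n ?lerDl //.
  exact: le_trans ks (ler_norm _).
have [le|gt] := leqP (2 * n) p.
  by apply: key; rewrite ?divr_ge0 ?ler0n ?sin_pi_frac_ge.
by rewrite sinE addrC; apply: key; rewrite ?divr_ge0 ?ler0n ?sin_pi_frac_ge //; lia.
Qed.

Lemma half_coef_le (p : nat) (a : 'F_p) : prime p -> a != 0 ->
  `|Fp_coef R[i] p (zeta p) (half_interval p) a| <=
  (p%:R / a%:R + p%:R / (p - a)%:R)%:C.
Proof.
move=> p_pr a0.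
have := norm_half_coef _ _ _ a p_pr (zeta_primitive p p_pr).
rewrite norm_1_sub_zetaX; set s := `|sin _|; set B := _ + _.
have := normr_ge0 (Fp_coef R[i] p (zeta p) (half_interval p) a).
move: `|_| => c c0 cs.
have B0 : 0 <= B by rewrite addr_ge0 // divr_ge0 ?ler0n.
have Bs : 1 <= B * s.
  apply: inv_sin_pi_frac_le; rewrite Fp_ltn // andbT lt0n.
  by apply: contraNneq a0 => a0; apply/eqP/val_inj.
(* The chain is [c <= c (B s) = (B / 2) (c (2 s)) <= (B / 2) 2 = B]. *)
apply: (@le_trans _ _ (c * (B * s)%:C)).
  by rewrite ler_peMr // -[1]/(1%:C) lecR.
rewrite (_ : c * _ = (B / 2)%:C * (c * (2 * s)%:C)); last first.
  by rewrite [RHS]mulrCA -rmorphM /=; congr (_ * _); congr (_%:C); field.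
apply: (@le_trans _ _ ((B / 2)%:C * 2)).
  by rewrite ler_wpM2l // -[0]/(0%:C) lecR divr_ge0.
by rewrite -(rmorph_nat (@real_complex R)) -rmorphM /= lecR; lra.
Qed.

(** Follows from [ln (1 / 2) <= - 1 / 2]; it lets constants be absorbed into [ln p]. *)
Lemma ln_ge_half (p : nat) : (1 < p)%N -> 1 / 2 <= ln p%:R :> R.
Proof.
move=> p1.
have : ln (1 + - 2^-1) <= - 2^-1 :> R by apply: le_ln1Dx; lra.
rewrite (_ : 1 + - 2^-1 = 2^-1 :> R); last by lra.
rewrite lnV ?posrE // => l2.
apply: le_trans (_ : ln 2 <= _); first by lra.
by rewrite ler_ln ?posrE ?ltr0n ?ler_nat // ltnW.
Qed.

(** Frequency 0 contributes at most [p], the others at most [2 p (1 + ln p)]. As [ln p >= 1 / 2],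
    the part [3 p] is at most [6 p ln p], whence the 8. *)
Lemma sum_half_coef_le (p : nat) : prime p ->
  \sum_a `|Fp_coef R[i] p (zeta p) (half_interval p) a| <=
  (8 * p%:R * ln p%:R)%:C.
Proof.
move=> p_pr; have p1 := prime_gt1 p_pr.
have ln_ge := ln_ge_half p p1.
rewrite (bigD1 0) //=.
have c0 : `|Fp_coef R[i] p (zeta p) (half_interval p) 0| <= (p%:R)%:C.
  rewrite /Fp_coef; under eq_bigr do rewrite mul0r oppr0 Fp_char0.
  rewrite sumr_const normr_nat card_half_interval //.
  by rewrite -(rmorph_nat (@real_complex R)) lecR ler_nat; lia.
apply: (le_trans (lerD c0 (ler_sum _ (fun a => half_coef_le p a p_pr)))).
rewrite -rmorph_sum -rmorphD /= lecR.
have -> : \sum_(a : 'F_p | a != 0) (p%:R / a%:R + p%:R / (p - a)%:R) =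
  2 * p%:R * \sum_(1 <= k < p) k%:R^-1 :> R.
  rewrite (big_Fp_nonzero _ _ _ _ (fun k => p%:R / k%:R + p%:R / (p - k)%:R)) //.
  (* The reflection [k -> p - k] turns the second sum into the first. *)
  rewrite big_split /= -!mulr_sumr [X in _ + _ * X]big_nat_rev /=.
  rewrite [X in _ + _ * X](_ : _ = \sum_(1 <= k < p) k%:R^-1); first by ring.
  by apply: eq_big_nat => k k_p; congr (_%:R^-1); lia.
have : \sum_(1 <= k < p) k%:R^-1 <= 1 + ln p%:R :> R.
  case: p p1 {p_pr ln_ge c0} => [|[|n]] // _.
  apply: le_trans (harmonic_le_ln n) _.
  by rewrite lerD2l ler_ln ?posrE ?ltr0n ?ler_nat.
have : 0 < p%:R :> R by rewrite ltr0n ltnW.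
move: (\sum_(1 <= k < p) _) => H; nra.
Qed.

(** The counting bound divided by [p ^ 2]: two coefficient sums of at most [8 p ln p] leave
    [64 = 8 ^ 2] and no power of [p] beyond the square root. *)
Lemma card_low_hits_ge (p : nat) : prime p -> odd p ->
  p.-1./2%:R ^+ 2 / p%:R - 64 * (Num.sqrt p%:R * ln p%:R ^+ 2) <=
  #|low_hits p|%:R :> R.
Proof.
move=> p_pr p_odd; have p0 : 0 < p%:R :> R by rewrite ltr0n prime_gt0.
have := count_hits_bound _ _ _ p_pr (zeta_primitive p p_pr)
  (half_interval p) (half_interval p) p_odd.
rewrite -/(low_hits p) card_half_interval //.
have -> : sqrtC p%:R = (Num.sqrt p%:R)%:C :> R[i].
  apply/eqP; rewrite -(eqrXn2 (n := 2)) ?sqrtC_ge0 ?ler0n //; last first.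
    by rewrite -[0]/(0%:C) lecR sqrtr_ge0.
  by rewrite sqrtCK -rmorphXn /= sqr_sqrtr ?ltW // rmorph_nat.
set M := \sum_a _; have M0 : 0 <= M by apply: sumr_ge0.
have hM := sum_half_coef_le p p_pr.
set N := #|low_hits p| => le1.
have le2 : (Num.sqrt p%:R)%:C * M * M <= (Num.sqrt p%:R)%:C *
    (8 * p%:R * ln p%:R)%:C * (8 * p%:R * ln p%:R)%:C.
  have s0 : 0 <= (Num.sqrt p%:R)%:C :> R[i] by rewrite -[0]/(0%:C) lecR sqrtr_ge0.
  by apply: ler_pM; rewrite ?mulr_ge0 //; apply: ler_pM.
have := le_trans le1 le2; rewrite distrC.
have -> : p%:R * p.-1./2%:R * p.-1./2%:R - p%:R ^+ 2 * N%:R =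
  (p%:R * p.-1./2%:R * p.-1./2%:R - p%:R ^+ 2 * N%:R)%:C :> R[i].
  by rewrite rmorphB /= !rmorphM /= !rmorph_nat.
(* The order on [R[i]] is partial, so bounding a number by its modulus requires it to be real. *)
have D_real (r : R) : r%:C \is Num.real by apply/complex_realP; exists r.
move/(le_trans (real_ler_norm (D_real _))).
rewrite -!(rmorphM (real_complex R)) /= lecR.
rewrite lerBlDr => le3; rewrite lerBlDr ler_pdivrMr //.
rewrite -(ler_pM2l p0) expr2 [leLHS]mulrA; apply: (le_trans le3).
by rewrite le_eqVlt; apply/orP; left; apply/eqP; ring.
Qed.

End RealBounds.

Theorem theorem13 (R : realType) :
  exists2 C : R, 0 < C &
    forall p : nat, prime p -> odd p ->
      exists2 E : R,
        `|E| <= C * (Num.sqrt p%:R * ln p%:R ^+ 2) &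
        5 / 8 * p%:R + E <= (V2 p 0 p.-1)%:R.
Proof.
(* With [X = sqrt p ln^2 p], the bounds give [2 V2 >= 5p/4 - 3/2 - 64 X], so
   [V2 >= 5p/8 - 3/4 - 32 X]. Since [X >= 1/4], the [3/4] costs at most [3 X], and [32 + 3 = 35]. *)
exists 35 => // p p_pr p_odd.
have X0 : 0 <= Num.sqrt p%:R * ln p%:R ^+ 2 :> R.
  by rewrite mulr_ge0 ?sqrtr_ge0 ?sqr_ge0.
exists (- (35 * (Num.sqrt p%:R * ln p%:R ^+ 2))).
  by rewrite normrN ger0_norm // mulr_ge0.
have p1 := prime_gt1 p_pr.
have := V2_ge p p_pr p_odd; rewrite -(ler_nat R) natrD !natrM.
have := card_low_hits_ge R p p_pr p_odd.
have -> : p.-1./2%:R = (p%:R - 1) / 2 :> R.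
  have : p%:R = (p.-1./2 * 2 + 1)%:R :> R by congr _%:R; lia.
  by rewrite natrD natrM => ->; field.
have X1 : 1 / 4 <= Num.sqrt p%:R * ln p%:R ^+ 2 :> R.
  have s1 : 1 <= Num.sqrt p%:R :> R.
    by rewrite -[leLHS]sqrtr1 ler_sqrt ?ler1n ?ltr0n ?prime_gt0.
  have := ln_ge_half R p p1; nra.
(* The right side exceeds the left by exactly [1 / (4 p)]. *)
have : p%:R / 4 - 1 / 2 <= ((p%:R - 1) / 2) ^+ 2 / p%:R :> R.
  have p0 : 0 < p%:R :> R by rewrite ltr0n ltnW.
  by rewrite ler_pdivlMr //; nra.
move: (_ / p%:R) (Num.sqrt _ * _) X0 X1 => q X; lra.
Qed.
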